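(* Let $(H,\langle\cdot,\cdot\rangle)$ be a real Hilbert space, let $D\subseteq H$ be an open and convex set, let $T:D\to H$ be an operator of class $C^1$ and let $A:H\to H$ be an operator (an arbitrary map). Assume that for all $x,y\in D$ with $A(x)\neq A(y)$ and all $z\in (x,y)$ one has $$\langle dT_{z}(y-x),A(y)-A(x)\rangle>0.$$ Then $T$ is strictly monotone relative to $A$.
   Context: For $x,y\in H$, $(x,y)=\{x+t(y-x):0<t<1\}$ denotes the open line segment with endpoints $x$ and $y$. For a differentiable operator $T:D\to H$ on an open set $D\subseteq H$, $dT_x(\cdot)$ denotes the Fréchet differential of $T$ at $x\in D$. Given operators (maps) $T:D\subseteq H\to H$ and $A:H\to H$, $T$ is called monotone relative to $A$ if $\langle T(x)-T(y),A(x)-A(y)\rangle\ge 0$ for all $x,y\in D$; $T$ is called strictly monotone relative to $A$ if in addition equality in this inequality holds only for $A(x)=A(y)$. *)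

(* Defs.v *)
From HB Require Import structures.
From mathcomp Require Import all_boot all_order all_algebra.
From mathcomp Require Import all_classical all_reals all_analysis.

Set Implicit Arguments.
Unset Strict Implicit.
Unset Printing Implicit Defensive.

Import Order.TTheory GRing.Theory Num.Theory.
Import numFieldNormedType.Exports.

Local Open Scope classical_set_scope.
Local Open Scope ring_scope.

(* A real Hilbert space is a complete normed space H together with a positive
   definite symmetric bilinear form inducing its norm. *)
Definition hilbert_inner_product (R : realType) (H : completeNormedModType R)
    (dot : {dot H for @idfun R}) : Prop :=
  forall x : H, `|x| = Num.sqrt (dot x x).

Definition open_segment (R : realType) (V : lmodType R) (x y : V) : set V :=
  [set x + t *: (y - x) | t in [set t : R | 0 < t < 1]].

(* The second clause is the continuity of x |-> 'd f x on D for the operator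
   norm: |'d f y - 'd f x| <= e for y in D close to x. As 'd f x is the
   differential of a map on the whole space, D is meant to be open. *)
Definition class_C1 (R : realType) (V W : normedModType R) (D : set V)
    (f : V -> W) : Prop :=
  (forall x, D x -> differentiable f x) /\
  (forall x, D x -> forall e : R, 0 < e ->
     \forall y \near within D (nbhs x),
       forall h : V, `|'d f y h - 'd f x h| <= e * `|h|).

(* An operator T : D -> H is encoded by a total map of which only the values on
   D are used. *)
Definition monotone_rel (R : realType) (H : lmodType R)
    (dot : {dot H for @idfun R}) (D : set H) (T A : H -> H) : Prop :=
  forall x y, D x -> D y -> 0 <= dot (T x - T y) (A x - A y).

Definition strictly_monotone_rel (R : realType) (H : lmodType R)
    (dot : {dot H for @idfun R}) (D : set H) (T A : H -> H) : Prop :=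
  monotone_rel dot D T A /\
  (forall x y, D x -> D y -> dot (T x - T y) (A x - A y) = 0 -> A x = A y).

(* Main.v *)
(** On the segment from [x] to [y] the real function
    [t |-> <T (x + t (y - x)), A y - A x>] has derivative
    [<dT_z (y - x), A y - A x>] with [z = x + t (y - x)], which is positive for
    [0 < t < 1] when [A x <> A y]. By the mean value theorem its values at [0]
    and [1] differ by a positive number, namely [<T y - T x, A y - A x>]. *)
Require Import Defs.
From HB Require Import structures.
From mathcomp Require Import all_boot all_order all_algebra.
From mathcomp Require Import all_classical all_reals all_analysis.
From mathcomp Require Import lra.
Import Order.TTheory GRing.Theory Num.Theory.
Import numFieldNormedType.Exports.
Local Open Scope classical_set_scope.
Local Open Scope ring_scope.

Lemma hilbert_dotxx {R : realType} {H : completeNormedModType R}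
    {dot : {dot H for @idfun R}} (hdot : hilbert_inner_product dot) (u : H) :
  dot u u = `|u| ^+ 2.
Proof.
rewrite hdot sqr_sqrtr //.
(* Squaring undoes the square root once [dot u u] is nonnegative; definiteness gives this only for
   nonzero [u]. *)
have [->|u0] := eqVneq u 0; first by rewrite linear0r.
exact/ltW/neq0_dnorm_gt0.
Qed.

(* Polarization: it reduces the continuity of the form to that of the norm. *)
Lemma hilbert_dotE {R : realType} {H : completeNormedModType R}
    {dot : {dot H for @idfun R}} (hdot : hilbert_inner_product dot) (u v : H) :
  dot u v = 4^-1 * (`|u + v| ^+ 2 - `|u - v| ^+ 2).
Proof.
by rewrite -!(hilbert_dotxx hdot) (hnormD dot) (hnormB dot) expr0 mul1r /=; lra.
Qed.

Lemma hilbert_dot_continuousl {R : realType} {H : completeNormedModType R}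
    {dot : {dot H for @idfun R}} (hdot : hilbert_inner_product dot) (v : H) :
  continuous (fun u : H => dot u v : R^o).
Proof.
have normD_cvg (u w : H) : `|z + w| @[z --> u] --> `|u + w|.
  by apply: cvg_norm; apply: cvgD; [exact: cvg_id|exact: cvg_cst].
have sqrD_cvg (u w : H) : `|z + w| ^+ 2 @[z --> u] --> `|u + w| ^+ 2.
  by under eq_fun do rewrite expr2; rewrite expr2; exact: cvgM (normD_cvg u w) (normD_cvg u w).
move=> u; rewrite /continuous_at (hilbert_dotE hdot).
under eq_fun do rewrite (hilbert_dotE hdot).
by apply: cvgM; [exact: cvg_cst|exact: cvgB (sqrD_cvg u v) (sqrD_cvg u (- v))].
Qed.

(** A continuous linear map is its own differential. *)
Lemma is_diff_hilbert_dotl {R : realType} {H : completeNormedModType R}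
    {dot : {dot H for @idfun R}} (hdot : hilbert_inner_product dot) (v u : H) :
  is_diff u (fun w : H => dot w v : R^o) (fun w : H => dot w v : R^o).
Proof.
pose l : H -> R^o := fun w => dot w v.
have lP : linear l by move=> a w1 w2; rewrite /l linearPl.
pose L : {linear H -> R^o} := HB.pack l (GRing.isLinear.Build _ _ _ _ _ lP).
have Lc : continuous L := hilbert_dot_continuousl hdot v.
split; first exact: (@linear_differentiable _ _ _ L).
exact: (@diff_lin _ _ _ L).
Qed.

Lemma segment_in_convex {R : realType} {V : lmodType R} {D : set V}
    (convexD : convex_set D) (x y : V) (t : R) :
  D x -> D y -> 0 <= t <= 1 -> D (x + t *: (y - x)).
Proof.
move=> Dx Dy /andP[t0 t1].
have s0 : 0 <= 1 - t by rewrite subr_ge0.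
have s1 : 1 - t <= 1 by rewrite gerBl.
(* The parameter of a convex combination is the weight of its first point, hence [1 - t] for [x]. *)
have /set_mem := convexD x y (Itv01 s0 s1) (mem_set Dx) (mem_set Dy).
rewrite /conv /= /unstable.onem subKr.
by rewrite scalerBl scale1r scalerBr addrA addrAC.
Qed.

(** Chain rule: the affine path has differential [s *: v], and evaluating at [s = 1] leaves [v]. *)
Lemma is_derive_along_segment {R : realType} {V W : normedModType R}
    {f : V -> W} (x v : V) (t : R) :
  differentiable f (x + t *: v) ->
  is_derive t 1 (fun s : R => f (x + s *: v)) ('d f (x + t *: v) v).
Proof.
move=> df.
have dgam : is_diff t (fun s : R^o => x + s *: v) (fun s : R^o => s *: v).
  by apply: is_diff_eq; rewrite add0r.
have dfgam : differentiable (fun s : R^o => f (x + s *: v)) t.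
  exact: (@differentiable_comp _ _ _ _ (fun s : R^o => x + s *: v) f).
apply: DeriveDef; first exact/derivable1_diffP.
rewrite deriveE //.
rewrite (@diff_comp _ _ _ _ (fun s : R^o => x + s *: v) f) //=.
by rewrite diff_val scale1r.
Qed.

(** The fixed vector [a] stands for the increment of [A], so that [A], which has no regularity,
    stays out of the calculus. *)
Lemma dot_increment_gt0 {R : realType} {H : completeNormedModType R}
    {dot : {dot H for @idfun R}} (hdot : hilbert_inner_product dot)
    {D : set H} (convexD : convex_set D) {T : H -> H}
    (dT : forall z, D z -> differentiable T z) (x y a : H) :
  D x -> D y ->
  (forall z, open_segment x y z -> 0 < dot ('d T z (y - x)) a) ->
  0 < dot (T y - T x) a.
Proof.
move=> Dx Dy pos.
pose gam (t : R) := x + t *: (y - x).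
have Dgam (t : R) : 0 <= t <= 1 -> D (gam t) by exact: segment_in_convex.
pose g (t : R) : R := dot (T (gam t)) a.
(* The endpoints are included because the mean value theorem also asks for continuity on the closed
   interval. *)
have dg (t : R) : 0 <= t <= 1 -> is_derive t 1 g (dot ('d T (gam t) (y - x)) a).
  move=> /Dgam/dT dTt.
  pose h (u : H) : R^o := dot (T u) a.
  have [dl El] := is_diff_hilbert_dotl hdot a (T (gam t)).
  have dh : differentiable h (gam t) by exact: (differentiable_comp dTt dl).
  have -> : dot ('d T (gam t) (y - x)) a = 'd h (gam t) (y - x).
    by rewrite (diff_comp dTt dl) /= El.
  exact: is_derive_along_segment.
have [c c01 E] : exists2 c, c \in `]0, 1[%R &
    g 1 - g 0 = dot ('d T (gam c) (y - x)) a * (1 - 0).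
  apply: MVT => //.
  - by move=> t; rewrite in_itv /= => /andP[t0 t1]; apply: dg; rewrite !ltW.
  - apply: derivable_within_continuous => t; rewrite in_itv /= => t01.
    by have [] := dg t t01.
have -> : dot (T y - T x) a = g 1 - g 0.
  by rewrite linearBl /g /gam scale1r scale0r addr0 subrKC.
rewrite E subr0 mulr1; apply: pos; exists c => //.
Qed.

Theorem proposition2p1 (R : realType) (H : completeNormedModType R)
    (dot : {dot H for @idfun R}) (hdot : hilbert_inner_product dot)
    (D : set H) (openD : open D) (convexD : convex_set D)
    (T : H -> H) (C1T : class_C1 D T) (A : H -> H)
    (hpos : forall x y : H, D x -> D y -> A x <> A y ->
       forall z : H, open_segment x y z ->
         0 < dot ('d T z (y - x)) (A y - A x)) :
  strictly_monotone_rel dot D T A.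
Proof.
have pos x y : D x -> D y -> A x <> A y -> 0 < dot (T x - T y) (A x - A y).
  (* The increment runs from [y] to [x] here, so the hypothesis is used with the two points
     exchanged. *)
  move=> Dx Dy /nesym Axy.
  apply: (dot_increment_gt0 hdot convexD (proj1 C1T)) => // z.
  exact: hpos.
(* If [A x = A y] the pairing vanishes; otherwise [pos] gives the inequality and excludes
   equality. *)
split=> x y Dx Dy; have [Axy|/eqP Axy] := eqVneq (A x) (A y) => //.
- by rewrite Axy subrr linear0r.
- exact/ltW/pos.
- by move=> E; have := pos x y Dx Dy Axy; rewrite E ltxx.
Qed.
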